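(* Let $\beta\in(0,1)$. Consider any sampling rule which, if applied with no stopping rule, satisfies $\mathbb{E}[T_\beta^\epsilon]<\infty$ for all $\epsilon>0$. Fix any $\alpha>1$. If this sampling rule is applied with Chernoff's stopping rule $\tau_\delta$ with threshold $\gamma_{n,\delta}^\alpha=\log(Cn^\alpha/\delta)$, then $$\limsup_{\delta\to0}\frac{\mathbb{E}[\tau_\delta]}{\log(1/\delta)}\le\frac{\alpha}{\Gamma_\beta^*}.$$
   Context: Setting: $k\ge 2$, $A=\{1,\dots,k\}$ is the set of arms, $\sigma>0$ is known, and $\mu_1>\mu_2>\dots>\mu_k$ are fixed real numbers (the true means). Rewards $Y_{n,i}\sim N(\mu_i,\sigma^2)$ are independent over $n\in\mathbb{N}=\{1,2,\dots\}$ and $i\in A$. A sampling rule selects at each time $n$ an arm $I_n$ as a function of past observations and possibly independent randomization; then $Y_{n,I_n}$ is observed. $T_{n,i}=\sum_{\ell=1}^{n-1}\mathbf{1}\{I_\ell=i\}$. Posterior means: starting from a prior $N(\mu_{1,i},\sigma_{1,i}^2)$ for each arm (either all $\sigma_{1,i}\in(0,\infty)$, or improper with $\mu_{1,i}=0,\sigma_{1,i}=\infty$ for all $i$, where $\sigma_{1,i}^{-2}=0$), the parameters are updated by: if $I_n=i$, then $\mu_{n+1,i}=(\sigma_{n,i}^{-2}\mu_{n,i}+\sigma^{-2}Y_{n,i})/(\sigma_{n,i}^{-2}+\sigma^{-2})$ and $\sigma_{n+1,i}^2=1/(\sigma_{n,i}^{-2}+\sigma^{-2})$; if $I_n\ne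 i$, both are unchanged. Proportions and complexity: $w_1^\beta=\beta$ and $(w_2^\beta,\dots,w_k^\beta)$ is the unique vector of positive numbers with $\sum_{i=2}^kw_i^\beta=1-\beta$ for which $\frac{(\mu_i-\mu_1)^2}{1/w_i^\beta+1/\beta}$ takes the same value for all $i=2,\dots,k$; $\Gamma_\beta^*=\frac{(\mu_i-\mu_1)^2}{2\sigma^2(1/w_i^\beta+1/\beta)}$ for any such $i$. Define $$T^\epsilon_\beta=\inf\{N\in\mathbb{N}: |\mu_{n,i}-\mu_i|\le\epsilon \text{ and } |T_{n,i}/n-w_i^\beta|\le\epsilon\ \ \forall i\in A,\ \forall n\ge N\}.$$ Chernoff's stopping rule: let $\hat\mu_{n,i}=T_{n,i}^{-1}\sum_{\ell=1}^{n-1}\mathbf{1}\{I_\ell=i\}Y_{\ell,I_\ell}$ be the empirical mean ($\hat\mu_{n,i}=0$ if $T_{n,i}=0$), $d(x,y)=(x-y)^2/(2\sigma^2)$, and $\hat\mu_{n,i,j}=\frac{T_{n,i}\hat\mu_{n,i}+T_{n,j}\hat\mu_{n,j}}{T_{n,i}+T_{n,j}}$. If $\hat\mu_{n,i}\ge\hat\mu_{n,j}$, set $Z_{n,i,j}=T_{n,i}d(\hat\mu_{n,i},\hat\mu_{n,i,j})+T_{n,j}d(\hat\mu_{n,j},\hat\mu_{n,i,j})$; if $\hat\mu_{n,i}<\hat\mu_{n,j}$, set $Z_{n,i,j}=-Z_{n,j,i}$; if $T_{n,i}=T_{n,j}=0$, set $Z_{n,i,j}=0$. With a threshold $\gamma_{n,\delta}$,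 $\delta\in(0,1)$, $$\tau_\delta=\inf\Big\{n\in\mathbb{N}: \max_{i\in A}\min_{j\in A\setminus\{i\}}Z_{n,i,j}>\gamma_{n,\delta}\Big\}.$$ Here $C=C(\alpha,k)>0$ is a constant, depending only on $\alpha$ and $k$ (known to exist), such that with threshold $\log(Cn^\alpha/\delta)$, under any sampling rule, $\mathbb{P}(\tau_\delta<\infty,\ \arg\max_i\hat\mu_{\tau_\delta,i}\neq1)\le\delta$. *)

(* Defs.v *)
From HB Require Import structures.
From mathcomp Require Export all_boot all_order all_algebra.
From mathcomp Require Export all_classical all_reals all_analysis.

Set Implicit Arguments.
Unset Strict Implicit.
Unset Printing Implicit Defensive.

Export Order.TTheory GRing.Theory Num.Theory.
Export numFieldNormedType.Exports.

Local Open Scope classical_set_scope.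
Local Open Scope ring_scope.

(* Arms are the elements of 'I_k, so arm number 1 of the text is the ordinal
   of value 0. Time steps are the positive naturals; values at time 0 are
   never used. *)
Definition arm1 (k : nat) (hk : (1 < k)%N) : 'I_k := Ordinal (ltnW hk).

(* A sampling rule maps a random seed and the past (arm, observation) pairs,
   oldest first, to the next arm. Since 'I_k is discrete, joint measurability
   is measurability in the seed and the observations for each fixed sequence
   of past arms. *)
Record sampling_rule (R : realType) (k : nat) (d : measure_display)
    (S : measurableType d) := SamplingRule {
  select :> S -> seq ('I_k * R) -> 'I_k ;
  select_measurable : forall (n : nat) (a : n.-tuple 'I_k) (i : 'I_k),
    measurable [set x : S * n.-tuple R | select x.1 (zip a x.2) = i]
}.

Section SamplePath.
Context (R : realType) (k : nat).
Implicit Types (y : nat -> 'I_k -> R) (I : nat -> 'I_k) (n : nat) (i j : 'I_k).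

(* The first n pairs (I_l, Y_{l,I_l}) produced by the rule from the seed u and
   the array y of potential rewards. *)
Fixpoint history (d : measure_display) (S : measurableType d)
    (rule : sampling_rule R k S) (u : S) y n : seq ('I_k * R) :=
  if n is m.+1 then
    let h := history rule u y m in
    rcons h (rule u h, y m.+1 (rule u h))
  else [::].

Definition arm (d : measure_display) (S : measurableType d)
    (rule : sampling_rule R k S) (u : S) y n : 'I_k :=
  rule u (history rule u y n.-1).

Definition pulls I n i : nat := (\sum_(1 <= l < n) (I l == i))%N.

(* The improper prior has standard deviation +oo, whose inverse square is 0. *)
Definition valid_prior (m1 : 'I_k -> R) (s1 : 'I_k -> \bar R) : Prop :=
  (forall i, (0 < s1 i < +oo)%E) \/ (forall i, m1 i = 0 /\ s1 i = +oo%E).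

(* A posterior is a pair (mean, variance). *)
Definition bayes_update (sigma : R) (post : R * \bar R) (obs : R) : R * \bar R :=
  let prec := fine (post.2^-1)%E in
  ((prec * post.1 + sigma ^- 2 * obs) / (prec + sigma ^- 2),
   ((prec + sigma ^- 2)^-1)%:E).

Fixpoint posterior_after (sigma : R) (m1 : 'I_k -> R) (s1 : 'I_k -> \bar R)
    I y (m : nat) i : R * \bar R :=
  if m is l.+1 then
    let post := posterior_after sigma m1 s1 I y l i in
    if I m == i then bayes_update sigma post (y m i) else post
  else (m1 i, (s1 i ^+ 2)%E).

(* mu_{n,i}: the parameters indexed by n incorporate n - 1 observations. *)
Definition post_mean (sigma : R) (m1 : 'I_k -> R) (s1 : 'I_k -> \bar R)
    I y n i : R :=
  (posterior_after sigma m1 s1 I y n.-1 i).1.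

(* Infimum in N u {+oo}, with inf of the empty set equal to +oo. *)
Definition inf_time (A : set nat) : \bar R :=
  ereal_inf [set (n%:R%:E : \bar R) | n in A].

Definition T_eps (sigma : R) (m1 : 'I_k -> R) (s1 : 'I_k -> \bar R)
    (mu w : 'I_k -> R) (eps : R) I y : \bar R :=
  inf_time [set N | (0 < N)%N /\ forall n, (N <= n)%N -> forall i,
    `|post_mean sigma m1 s1 I y n i - mu i| <= eps /\
    `|(pulls I n i)%:R / n%:R - w i| <= eps].

(* 0 when there is no observation, as 0^-1 = 0. *)
Definition emp_mean I y n i : R :=
  (pulls I n i)%:R^-1 * \sum_(1 <= l < n | I l == i) y l (I l).

Definition kl (sigma x y : R) : R := (x - y) ^+ 2 / (2 * sigma ^+ 2).

Definition pooled_mean I y n i j : R :=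
  ((pulls I n i)%:R * emp_mean I y n i + (pulls I n j)%:R * emp_mean I y n j)
  / ((pulls I n i)%:R + (pulls I n j)%:R).

Definition glr (sigma : R) I y n i j : R :=
  (pulls I n i)%:R * kl sigma (emp_mean I y n i) (pooled_mean I y n i j) +
  (pulls I n j)%:R * kl sigma (emp_mean I y n j) (pooled_mean I y n i j).

Definition Zstat (sigma : R) I y n i j : R :=
  if (pulls I n i == 0%N) && (pulls I n j == 0%N) then 0
  else if emp_mean I y n j <= emp_mean I y n i then glr sigma I y n i j
  else - glr sigma I y n j i.

Definition chernoff_time (sigma : R) (gamma : nat -> R) I y : \bar R :=
  inf_time [set n | (0 < n)%N /\
    ((gamma n)%:E < \big[maxe/-oo]_(i < k)
       \big[mine/+oo]_(j < k | j != i) (Zstat sigma I y n i j)%:E)%E].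

Definition emp_best I y n : set 'I_k :=
  [set i | forall j, emp_mean I y n j <= emp_mean I y n i].

End SamplePath.

Definition threshold (R : realType) (C alpha delta : R) (n : nat) : R :=
  ln (C * n%:R `^ alpha / delta).

(* Product rule over every finite subfamily, for a family of sigma-algebras. *)
Definition mutually_independent (R : realType) (d : measure_display)
    (Omega : measurableType d) (P : probability Omega R)
    (J : choiceType) (G : J -> set (set Omega)) : Prop :=
  forall (s : seq J) (A : J -> set Omega), uniq s ->
    (forall j, j \in s -> G j (A j)) ->
    P (\bigcap_(j in [set` s]) A j) = (\prod_(j <- s) P (A j))%E.

Section Model.
Context (R : realType) (k : nat) (dO dS : measure_display)
  (Omega : measurableType dO) (S : measurableType dS) (P : probability Omega R).

(* None stands for the seed and Some (n, i) for the reward at time n + 1. *)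
Definition bandit_sigma_algebras (U : {mfun Omega >-> S})
    (Y : nat -> 'I_k -> {RV P >-> R}) (j : option (nat * 'I_k)) :
    set (set Omega) :=
  if j is Some (n, i) then preimage_set_system setT (Y n.+1 i) measurable
  else preimage_set_system setT U measurable.

Definition bandit_model (sigma : R) (mu : 'I_k -> R) (U : {mfun Omega >-> S})
    (Y : nat -> 'I_k -> {RV P >-> R}) : Prop :=
  (forall n i B, (0 < n)%N -> measurable B ->
     distribution P (Y n i) B = normal_prob (mu i) sigma B) /\
  mutually_independent P (bandit_sigma_algebras U Y).

Definition rewards (Y : nat -> 'I_k -> {RV P >-> R}) (om : Omega) :
    nat -> 'I_k -> R :=
  fun n i => Y n i om.

Definition arms (rule : sampling_rule R k S) (U : {mfun Omega >-> S})
    (Y : nat -> 'I_k -> {RV P >-> R}) (om : Omega) : nat -> 'I_k :=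
  arm rule (U om) (rewards Y om).

End Model.

(* The error guarantee which qualifies C as a constant C(alpha, k): it holds
   with the same C for all means, variances, sampling rules and delta. *)
Definition valid_constant (R : realType) (k : nat) (hk : (1 < k)%N)
    (alpha C : R) : Prop :=
  forall (sigma : R) (mu : 'I_k -> R), 0 < sigma ->
    (forall i j : 'I_k, (i < j)%N -> mu j < mu i) ->
  forall (dO dS : measure_display) (Omega : measurableType dO)
    (S : measurableType dS) (P : probability Omega R)
    (U : {mfun Omega >-> S}) (Y : nat -> 'I_k -> {RV P >-> R})
    (rule : sampling_rule R k S), bandit_model sigma mu U Y ->
  forall delta : R, 0 < delta < 1 ->
    (P [set om | exists n : nat,
         chernoff_time sigma (threshold C alpha delta)
           (arms rule U Y om) (rewards Y om) = n%:R%:E /\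
         emp_best (arms rule U Y om) (rewards Y om) n <> [set arm1 hk]]
     <= delta%:E)%E.

Definition is_proportions (R : realType) (k : nat) (hk : (1 < k)%N)
    (mu : 'I_k -> R) (beta : R) (w : 'I_k -> R) : Prop :=
  [/\ w (arm1 hk) = beta,
      forall i, i != arm1 hk -> 0 < w i,
      \sum_(i < k | i != arm1 hk) w i = 1 - beta &
      forall i j, i != arm1 hk -> j != arm1 hk ->
        (mu i - mu (arm1 hk)) ^+ 2 / ((w i)^-1 + beta^-1) =
        (mu j - mu (arm1 hk)) ^+ 2 / ((w j)^-1 + beta^-1)].

Definition is_complexity (R : realType) (k : nat) (hk : (1 < k)%N) (sigma : R)
    (mu : 'I_k -> R) (beta : R) (w : 'I_k -> R) (Gamma : R) : Prop :=
  forall i, i != arm1 hk ->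
    Gamma = (mu i - mu (arm1 hk)) ^+ 2 /
            (2 * sigma ^+ 2 * ((w i)^-1 + beta^-1)).

(* Main.v *)
(* Let r < 1 satisfy r ^ 3 > 1 / alpha. For eps small and n >= T^eps_beta beyond
   a deterministic constant, the empirical means are within 2 eps of the true
   ones (the prior washes out as T_{n,i} grows linearly), so
   Z_{n,1,j} >= r ^ 3 Gamma n for every j <> 1. The threshold being
   ln (1 / delta) + O(ln n), the rule stops as soon as moreover
   n >= (alpha / Gamma) ln (1 / delta). Hence, on every sample path,
   tau_delta <= T^eps_beta + K + (alpha / Gamma) ln (1 / delta) with K
   independent of delta. The integral of a nonnegative function is a supremum
   over the simple functions below it, so this bound can be integrated without
   proving that either time is measurable. *)
Require Import Defs.
From mathcomp Require Import measurable_realfun ring lra.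

Import HBNNSimple.

Local Open Scope classical_set_scope.
Local Open Scope ring_scope.

(** * Integrals of nonnegative functions without measurability *)

Section Integral.
Context (d : measure_display) (T : measurableType d) (R : realType).
Implicit Types f g : T -> \bar R.
Local Open Scope ereal_scope.

Lemma ge0_le_integralT (mu : {measure set T -> \bar R}) f g :
  (forall x, 0 <= f x) -> (forall x, f x <= g x) ->
  \int[mu]_x f x <= \int[mu]_x g x.
Proof.
move=> f0 fg; have g0 x : 0 <= g x by exact: le_trans (fg x).
rewrite !ge0_integralTE//; apply: ereal_sup_le => _ [h hf <-].
by exists h => //= x; exact: le_trans (fg x).
Qed.

Lemma integral_le_add_cst (P : probability T R) f g (c : R) : (0 <= c)%R ->
  (forall x, 0 <= f x) -> (forall x, 0 <= g x) ->
  (forall x, f x <= g x + c%:E) ->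
  \int[P]_x f x <= \int[P]_x g x + c%:E.
Proof.
move=> c0 f0 g0 fg; rewrite [leLHS]ge0_integralTE//.
apply: ge_ereal_sup => _ [h hf <-]; rewrite -integralT_nnsfun.
(* The shift is moved onto the simple function [h], so that additivity applies to the measurable
   [t]: [h <= t + c] everywhere, and [t <= g] because [h <= g + c] and [g >= 0]. *)
pose t x := (Num.max (h x - c) 0)%R.
have mt : measurable_fun [set: T] t.
  apply: measurable_maxr; last exact: measurable_cst.
  by apply: measurable_funB; [exact: measurable_funP|exact: measurable_cst].
have t0 x : (0 <= t x)%R by rewrite le_max lexx orbT.
apply: (@le_trans _ _ (\int[P]_x ((t x)%:E + c%:E))).
  apply: ge0_le_integralT => x; rewrite ?lee_fin ?fun_ge0//.
  by rewrite -lerBlDr le_max lexx.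
rewrite ge0_integralD//.
- rewrite (integral_cst P measurableT c%:E) [X in _ * X]probability_setT.
  rewrite mule1 leeD2r//.
  apply: ge0_le_integralT => x; rewrite ?lee_fin// /t.
  rewrite EFin_max ge_max g0 andbT.
  by rewrite EFinB leeBlDr//; exact: le_trans (fg x).
- by move=> x _; rewrite lee_fin.
- exact/measurable_EFinP.
Qed.

End Integral.

(** * Asymptotics in [delta] and in [n] *)

Lemma limf_esup_le_affine_ln (R : realType) (f : R -> \bar R) (A c : R) :
  (forall x, 0 < x < 1 -> (f x <= (A + c * ln x^-1)%:E)%E) ->
  (limf_esup (fun x => f x / (ln x^-1)%:E) 0^'+ <= c%:E)%E.
Proof.
move=> fA; apply/lee_addgt0Pr => e e0.
(* Once [ln x^-1] exceeds [M], the intercept contributes at most [e] to the quotient. The extra 1 in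
   [V] keeps [x < 1] even when [A = 0]. *)
pose M := `|A| / e.
have M0 : 0 <= M by rewrite divr_ge0// ltW.
have d0 : 0 < expR (- (M + 1)) :> R by exact: expR_gt0.
pose V := [set x : R | 0 < x < expR (- (M + 1))].
have nV : (0 : R)^'+ V.
  near=> x; apply/andP; split; near: x.
    exact: nbhs_right_gt.
  exact: nbhs_right_lt.
apply: ge_ereal_inf.
exists (ereal_sup ((fun x => f x / (ln x^-1)%:E)%E @` V)); first by exists V.
apply: ge_ereal_sup => _ [x /andP[x0 xd] <-].
have L : M + 1 < ln x^-1.
  by rewrite lnV ?posrE// ltrNr -ltr_expR lnK ?posrE.
have L0 : 0 < ln x^-1 by apply: le_lt_trans L; rewrite addr_ge0.
have x1 : x < 1.
  by apply: lt_trans xd _; rewrite -expR0 ltr_expR oppr_lt0 ltr_wpDl.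
rewrite inver gt_eqF// lee_pdivrMr//.
apply: le_trans (fA _ _) _; first by rewrite x0.
rewrite -EFinD -EFinM lee_fin mulrDl addrC lerD2l.
apply: le_trans (ler_norm _) _.
have -> : `|A| = e * M by rewrite /M mulrC divfK ?gt_eqF.
by rewrite ler_pM2l// ltW// (le_lt_trans _ L)// lerDl.
Unshelve. all: by end_near.
Qed.

(** The bound [ln s < s] at [s = t * n] gives [ln n] slope [t]. With this [t], the term
    [alpha * ln n] uses half of the gap [b - a], and [n > x] lets the other half absorb the
    constants, none of which involves [delta]. *)
Lemma threshold_lt_linear (R : realType) (C alpha a b : R) :
  0 < C -> 0 < alpha -> a < b ->
  exists K : nat, forall delta n, 0 < delta -> (K <= n)%N ->
    ln delta^-1 <= a * n%:R -> threshold C alpha delta n < b * n%:R.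
Proof.
move=> C0 alpha0 ab; pose t := (b - a) / (2 * alpha).
have ba0 : 0 < b - a by rewrite subr_gt0.
have t0 : 0 < t by rewrite divr_gt0// mulr_gt0.
pose x := (ln C - alpha * ln t) / ((b - a) / 2).
exists (Num.truncn x).+1 => delta n delta0 Kn Ln.
have xn : x < n%:R.
  by apply: lt_le_trans (truncnS_gt _) _; rewrite ler_nat.
have n0 : 0 < n%:R :> R by rewrite ltr0n; exact: leq_trans Kn.
have -> : threshold C alpha delta n = ln C + alpha * ln n%:R + ln delta^-1.
  by rewrite /threshold !lnM ?posrE ?mulr_gt0 ?invr_gt0 ?powR_gt0// ln_powR.
have lnn : ln n%:R < t * n%:R - ln t.
  rewrite ltrBrDr addrC -lnM ?posrE//.
  by apply: ln_sublinear; rewrite mulr_gt0.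
have : alpha * ln n%:R < alpha * (t * n%:R - ln t) by rewrite ltr_pM2l.
have -> : alpha * (t * n%:R - ln t) = (b - a) / 2 * n%:R - alpha * ln t.
  by rewrite /t; field; rewrite gt_eqF.
move: xn; rewrite ltr_pdivrMr ?divr_gt0//; lra.
Qed.

(** * Posterior means versus empirical means on a sample path *)

Section SamplePath.
Context (R : realType) (k : nat).
Implicit Types (I : nat -> 'I_k) (y : nat -> 'I_k -> R) (i j : 'I_k).

(** Inverse variances treat both kinds of prior alike: the improper one has precision 0. *)
Definition precision (v : \bar R) : R := fine (v^-1)%E.

Lemma precision_prior (m1 : 'I_k -> R) (s1 : 'I_k -> \bar R) i :
  valid_prior m1 s1 -> 0 <= precision (s1 i ^+ 2)%E.
Proof.
move=> [/(_ i)|/(_ i)[_ ->]]; rewrite /precision.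
  case: (s1 i) => [s| |]; rewrite ?andbF// lte_fin => /andP[s0 _].
  by rewrite -EFin_expe inver gt_eqF ?exprn_gt0//= invr_ge0 sqr_ge0.
by rewrite expe2 mulyy invey.
Qed.

(** In the natural parameters (precision, precision times mean), the conjugate Gaussian update is
    addition. The mean is left multiplied by the precision, which vanishes for an improper prior
    before the first pull. *)
Lemma posterior_afterE (sigma : R) (m1 : 'I_k -> R) (s1 : 'I_k -> \bar R)
    I y m i : 0 < sigma -> 0 <= precision (s1 i ^+ 2)%E ->
  let post := posterior_after sigma m1 s1 I y m i in
  precision post.2 = precision (s1 i ^+ 2)%E + sigma ^- 2 * (pulls I m.+1 i)%:R /\
  precision post.2 * post.1 = precision (s1 i ^+ 2)%E * m1 i
    + sigma ^- 2 * \sum_(1 <= l < m.+1 | I l == i) y l (I l).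
Proof.
move=> sigma0 p0; elim: m => [|m [IH1 IH2]] /=.
  by rewrite /pulls !big_geq// !mulr0 !addr0.
have pullsS : pulls I m.+2 i = (pulls I m.+1 i + (I m.+1 == i))%N.
  by rewrite /pulls big_nat_recr.
have sumS : \sum_(1 <= l < m.+2 | I l == i) y l (I l) =
    \sum_(1 <= l < m.+1 | I l == i) y l (I l)
    + (if I m.+1 == i then y m.+1 i else 0).
  by rewrite big_mkcond big_nat_recr//= -big_mkcond; case: eqP => [->|].
rewrite pullsS sumS; case: ifPn => Ii; last by rewrite addn0 addr0.
rewrite /bayes_update -/(precision _).
have s0 : 0 < sigma ^- 2 by rewrite invr_gt0 exprn_gt0.
set p := precision (posterior_after _ _ _ _ _ _ _).2 in IH1 IH2 *.
have ps : 0 < p + sigma ^- 2.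
  by rewrite ltr_wpDl// IH1 addr_ge0// mulr_ge0// ltW.
have precV : precision ((p + sigma ^- 2)^-1)%:E = p + sigma ^- 2.
  by rewrite /precision inver gt_eqF ?invr_gt0//= invrK.
rewrite /= precV; split; first by rewrite IH1 natrD mulrDr mulr1 addrA.
by rewrite [LHS]mulrC divfK ?gt_eqF// IH2 mulrDr addrA.
Qed.

(** Solving the additive identity for the sum of rewards isolates the influence of the prior as a
    correction with denominator [pulls I n i]. *)
Lemma emp_meanE (sigma : R) (m1 : 'I_k -> R) (s1 : 'I_k -> \bar R)
    I y n i : 0 < sigma -> 0 <= precision (s1 i ^+ 2)%E ->
    (0 < pulls I n i)%N ->
  let m := post_mean sigma m1 s1 I y n i in
  emp_mean I y n i =
  m + sigma ^+ 2 * precision (s1 i ^+ 2)%E * (m - m1 i) / (pulls I n i)%:R.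
Proof.
move=> sigma0 p0 T0; have n0 : (0 < n)%N.
  by case: n T0 => //; rewrite /pulls big_geq.
rewrite /emp_mean /post_mean /=.
have [] := @posterior_afterE sigma m1 s1 I y n.-1 i sigma0 p0.
rewrite prednK// => -> E.
have T0' : (pulls I n i)%:R != 0 :> R by rewrite pnatr_eq0 -lt0n.
set S := \sum_(_ <= _ < _ | _) _ in E *.
set m := (posterior_after _ _ _ _ _ _ _).1 in E *.
have -> : S = sigma ^+ 2 * (sigma ^- 2 * S) by field; rewrite gt_eqF.
have -> : sigma ^- 2 * S = (precision (s1 i ^+ 2)%E
   + sigma ^- 2 * (pulls I n i)%:R) * m - precision (s1 i ^+ 2)%E * m1 i.
  by rewrite E addrC addKr.
by field; rewrite T0' gt_eqF.
Qed.

Lemma emp_mean_near (sigma : R) (m1 : 'I_k -> R) (s1 : 'I_k -> \bar R)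
    (mu w eps : R) i : 0 < sigma -> 0 <= precision (s1 i ^+ 2)%E ->
    0 < eps -> 0 < w - eps ->
  exists K : nat, forall I y n, (K <= n)%N ->
    `|post_mean sigma m1 s1 I y n i - mu| <= eps ->
    `|(pulls I n i)%:R / n%:R - w| <= eps ->
    `|emp_mean I y n i - mu| <= 2 * eps.
Proof.
move=> sigma0 p0 e0 we0.
(* [B] bounds the numerator of the prior correction when the posterior mean is within [eps] of [mu].
   The pull count being at least [(w - eps) * n], the correction is at most [eps] for [n > x]. *)
pose B := sigma ^+ 2 * precision (s1 i ^+ 2)%E * (eps + `|mu - m1 i|).
pose x := B / (eps * (w - eps)).
exists (Num.truncn x).+1 => I y n Kn Hm Hw.
have xn : x < n%:R.
  by apply: lt_le_trans (truncnS_gt _) _; rewrite ler_nat.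
have n0 : 0 < n%:R :> R by rewrite ltr0n; exact: leq_trans Kn.
have Tn : (w - eps) * n%:R <= (pulls I n i)%:R.
  by rewrite -ler_pdivlMr//; move: Hw; rewrite ler_norml; lra.
have T0 : 0 < (pulls I n i)%:R :> R by apply: lt_le_trans Tn; rewrite mulr_gt0.
rewrite (@emp_meanE sigma m1 s1)//; last by rewrite -(ltr0n R).
set m := post_mean _ _ _ _ _ _ _ in Hm *.
have c0 : 0 <= sigma ^+ 2 * precision (s1 i ^+ 2)%E.
  exact: mulr_ge0 (sqr_ge0 _) p0.
rewrite addrAC (_ : 2 * eps = eps + eps); last by rewrite mulr2n mulrDl mul1r.
apply: le_trans (ler_normD _ _) _; apply: lerD => //.
rewrite normrM normfV (gtr0_norm T0) ler_pdivrMr//.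
rewrite normrM (ger0_norm c0).
apply: (@le_trans _ _ B).
  rewrite ler_wpM2l//.
  rewrite (_ : m - m1 i = m - mu + (mu - m1 i)); last by rewrite addrA subrK.
  by apply: le_trans (ler_normD _ _) _; rewrite lerD2r.
move: xn; rewrite ltr_pdivrMr ?mulr_gt0// => /ltW/le_trans; apply.
by rewrite mulrCA ler_pM2l// mulrC.
Qed.

(** * Closed form and lower bound for the test statistic *)

Lemma glrE (sigma : R) I y n i j : 0 < sigma ->
  (0 < pulls I n i)%N -> (0 < pulls I n j)%N ->
  glr sigma I y n i j =
  (emp_mean I y n i - emp_mean I y n j) ^+ 2 /
  (2 * sigma ^+ 2 * ((pulls I n i)%:R^-1 + (pulls I n j)%:R^-1)).
Proof.
rewrite -2!(ltr0n R) /glr /pooled_mean /kl => s0.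
set a := (pulls I n i)%:R; set b := (pulls I n j)%:R => a0 b0.
(* The pooled mean is the barycentre with weights [a] and [b], so the weighted squared deviations
   add up to [a * b / (a + b)] times the squared gap. *)
by field; rewrite !gt_eqF// addr_gt0.
Qed.

(** The closed form is quadratic in the gap of means and homogeneous of degree one in the pull
    counts; losing a factor [r] in each costs [r ^+ 3] in all. *)
Lemma Zstat_lower_bound (sigma : R) I y n i j (r w1 w2 mu1 mu2 : R) :
  0 < sigma -> (0 < n)%N -> 0 < r -> 0 < w1 -> 0 < w2 -> mu2 <= mu1 ->
  r * w1 <= (pulls I n i)%:R / n%:R -> r * w2 <= (pulls I n j)%:R / n%:R ->
  r * (mu1 - mu2) <= emp_mean I y n i - emp_mean I y n j ->
  r ^+ 3 * ((mu2 - mu1) ^+ 2 / (2 * sigma ^+ 2 * (w2^-1 + w1^-1))) * n%:R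
  <= Zstat sigma I y n i j.
Proof.
rewrite -(ltr0n R) => s0 n0 r0 w10 w20 mu21.
rewrite !ler_pdivlMr// => ri rj rm.
have a0 : 0 < (pulls I n i)%:R :> R by apply: lt_le_trans ri; rewrite !mulr_gt0.
have b0 : 0 < (pulls I n j)%:R :> R by apply: lt_le_trans rj; rewrite !mulr_gt0.
have rm0 : 0 <= r * (mu1 - mu2) by rewrite mulr_ge0 ?subr_ge0// ltW.
have m0 : emp_mean I y n j <= emp_mean I y n i.
  by rewrite -subr_ge0; exact: le_trans rm.
rewrite /Zstat -!(eqr_nat R) gt_eqF//= m0 glrE// -1?(ltr0n R)//.
have -> : r ^+ 3 * ((mu2 - mu1) ^+ 2 / (2 * sigma ^+ 2 * (w2^-1 + w1^-1))) * n%:R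
   = (r * (mu1 - mu2)) ^+ 2 /
     (2 * sigma ^+ 2 * ((r * w1 * n%:R)^-1 + (r * w2 * n%:R)^-1)).
  by field; rewrite !gt_eqF// addr_gt0.
apply: ler_pM.
- exact: sqr_ge0.
- by rewrite ltW// invr_gt0 !mulr_gt0 ?exprn_gt0 ?addr_gt0 ?invr_gt0 ?mulr_gt0.
- by rewrite ler_sqr ?nnegrE//; exact: le_trans rm.
rewrite lef_pV2 ?posrE ?mulr_gt0 ?exprn_gt0 ?addr_gt0 ?invr_gt0 ?mulr_gt0//.
by rewrite ler_pM2l ?mulr_gt0 ?exprn_gt0// lerD// lef_pV2 ?posrE ?mulr_gt0.
Qed.

Lemma inf_time_ge0 (A : set nat) : (0 <= inf_time R A)%E.
Proof. by apply: le_ereal_inf_tmp => _ [n _ <-]; rewrite lee_fin. Qed.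

Lemma inf_time_le_add (A B : set nat) (M : nat) :
  (forall n, A n -> B (n + M)%N) -> (inf_time R B <= inf_time R A + M%:R%:E)%E.
Proof.
move=> AB; rewrite -leeBlDr//; apply: le_ereal_inf_tmp => _ [n An <-].
rewrite leeBlDr//; apply: ereal_inf_lbound; exists (n + M)%N; first exact: AB.
by rewrite natrD EFinD.
Qed.

End SamplePath.

(** * Pathwise comparison of the stopping time with [T_eps] *)

Lemma finite_positive_lower_bound (R : realDomainType) (T : finType)
    (D : pred T) (c : T -> R) : (forall i, D i -> 0 < c i) ->
  exists2 e : R, 0 < e & forall i, D i -> e <= c i.
Proof.
move=> c0; exists (\big[Num.min/1]_(i | D i) c i); first exact: lt_bigmin.
by move=> i Di; exact: bigmin_le_cond.
Qed.

(** The factor 4 anticipates two empirical means, each off by up to [2 * eps]: their gap then keeps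
    a fraction [1 - t] of the true one. *)
Lemma exists_tolerance (R : realType) (k : nat) (i1 : 'I_k)
    (mu w : 'I_k -> R) (t : R) : 0 < t ->
  (forall i, 0 < w i) -> (forall i, i != i1 -> mu i < mu i1) ->
  exists eps : R, [/\ 0 < eps, forall i, eps <= t * w i &
    forall i, i != i1 -> 4 * eps <= t * (mu i1 - mu i)].
Proof.
move=> t0 w0 mu1.
have [|e e0 ew] := @finite_positive_lower_bound R _ predT (fun i => t * w i).
  by move=> i _; rewrite mulr_gt0.
have [|e' e'0 emu] := @finite_positive_lower_bound R _ (fun i => i != i1)
  (fun i => t * (mu i1 - mu i)).
  by move=> i ?; rewrite mulr_gt0// subr_gt0 mu1.
exists (Num.min e (e' / 4)); split.
- by rewrite lt_min e0 divr_gt0.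
- by move=> i; rewrite ge_min ew.
- move=> i /emu; apply: le_trans.
  by rewrite mulrC -ler_pdivlMr// ge_min lexx orbT.
Qed.

Lemma complexity_gt0 (R : realType) (k : nat) (hk : (1 < k)%N) (sigma : R)
    (mu : 'I_k -> R) (beta : R) (w : 'I_k -> R) (Gamma : R) :
  0 < sigma -> (forall i j : 'I_k, (i < j)%N -> mu j < mu i) ->
  0 < beta -> is_proportions hk mu beta w ->
  is_complexity hk sigma mu beta w Gamma -> 0 < Gamma.
Proof.
move=> s0 mu_decr beta0 [_ wpos _ _] hGamma.
have i21 : Ordinal hk != arm1 hk by [].
rewrite (hGamma _ i21) divr_gt0//.
  by rewrite exprn_even_gt0//= subr_eq0 lt_eqF// mu_decr.
by rewrite !mulr_gt0 ?exprn_gt0// addr_gt0 ?invr_gt0 ?wpos.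
Qed.

Lemma chernoff_time_le_T_eps (R : realType) (k : nat) (hk : (1 < k)%N)
    (sigma : R) (mu : 'I_k -> R) (m1 : 'I_k -> R) (s1 : 'I_k -> \bar R)
    (beta : R) (w : 'I_k -> R) (Gamma alpha C : R) :
  0 < sigma -> (forall i j : 'I_k, (i < j)%N -> mu j < mu i) ->
  valid_prior m1 s1 -> 0 < beta -> is_proportions hk mu beta w ->
  is_complexity hk sigma mu beta w Gamma -> 1 < alpha -> 0 < C ->
  exists2 eps : R, 0 < eps & exists K : nat, forall I y delta, 0 < delta < 1 ->
    (chernoff_time sigma (threshold C alpha delta) I y <=
     T_eps sigma m1 s1 mu w eps I y
       + (K%:R + alpha / Gamma * ln delta^-1)%:E)%E.
Proof.
move=> s0 mu_decr prior_ok beta0 hw hGamma al1 C0.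
have Gamma0 := complexity_gt0 _ _ _ _ _ _ _ _ s0 mu_decr beta0 hw hGamma.
have [w1 wpos _ _] := hw.
set i1 := arm1 hk in w1 wpos hGamma.
have w0 i : 0 < w i.
  by have [->|] := eqVneq i i1; [rewrite w1|exact: wpos].
have mu1 i : i != i1 -> mu i < mu i1.
  by move=> ii1; apply: mu_decr; rewrite lt0n.
have al0 : 0 < alpha by exact: lt_trans al1.
have alV : alpha^-1 < 1 by rewrite invf_lt1.
have alV0 : 0 < alpha^-1 by rewrite invr_gt0.
(* The 6 makes [1 - 3 * t] the midpoint of [alpha^-1] and 1; Bernoulli's inequality
   [1 - 3 * t <= r ^+ 3] then gives [r3]. *)
pose t := (1 - alpha^-1) / 6; pose r := 1 - t.
have t0 : 0 < t by rewrite divr_gt0// subr_gt0.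
have r0 : 0 < r by rewrite /r /t; lra.
have r3 : alpha^-1 < r ^+ 3.
  have : 1 - 3 * t <= r ^+ 3.
    rewrite -subr_ge0 (_ : _ - _ = t ^+ 2 * (3 - t)); last by rewrite /r; ring.
    by rewrite mulr_ge0 ?sqr_ge0// /t; lra.
  by rewrite /t; lra.
have [eps [eps0 epsw epsmu]] := exists_tolerance _ _ i1 mu w _ t0 w0 mu1.
exists eps => //.
have weps i : 0 < w i - eps.
  have := epsw i; have : t * w i < w i by rewrite gtr_pMl// /t; lra.
  lra.
have /choice [K HK] : forall i, exists K : nat, forall I y n, (K <= n)%N ->
    `|post_mean sigma m1 s1 I y n i - mu i| <= eps ->
    `|(pulls I n i)%:R / n%:R - w i| <= eps ->
    `|emp_mean I y n i - mu i| <= 2 * eps.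
  by move=> i; apply: emp_mean_near => //; exact: precision_prior prior_ok.
(* The two slopes compare exactly by [r3]: [Gamma / alpha] is the rate at which [n] must dominate
   [ln delta^-1], [r ^+ 3 * Gamma] the growth rate of the statistic. *)
have [K' HK'] := @threshold_lt_linear R C alpha (Gamma / alpha) (r ^+ 3 * Gamma)
  C0 al0 ltac:(by rewrite mulrC ltr_pM2r).
pose K0 := (\max_i K i)%N.
exists (K0 + K' + 1)%N => I y delta /andP[d0 d1].
have L0 : 0 <= ln delta^-1.
  by rewrite lnV ?posrE// oppr_ge0 ln_le0// ltW.
set x := alpha / Gamma * ln delta^-1.
have x0 : 0 <= x by rewrite mulr_ge0// divr_ge0// ltW.
(* The three summands secure accurate empirical means, the threshold estimate and [n >= x]. Rounding
   [x] up costs at most the 1 in the constant chosen above. *)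
pose M := (K0 + K' + (Num.truncn x).+1)%N.
apply: (@le_trans _ _ (T_eps sigma m1 s1 mu w eps I y + M%:R%:E)%E); last first.
  rewrite leeD2l// lee_fin /M -addn1 !natrD -!addrA !lerD2l [leRHS]addrC lerD2r.
  by rewrite truncn_le.
(* Every [N] admissible for [T_eps] is shown to meet the stopping condition at time [N + M]. *)
apply: inf_time_le_add => N [N0 HN]; set n := (N + M)%N.
have Mn : (M <= n)%N by rewrite leq_addl.
have K0n : (K0 <= n)%N by apply: leq_trans Mn; rewrite /M -addnA leq_addr.
have K'n : (K' <= n)%N.
  by apply: leq_trans Mn; rewrite /M addnAC leq_addl.
have xn : x <= n%:R.
  apply: le_trans (ltW (truncnS_gt _)) _; rewrite ler_nat.
  by apply: leq_trans Mn; rewrite leq_addl.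
have n0 : (0 < n)%N by apply: leq_trans N0 _; exact: leq_addr.
split => //.
have near_n i : `|emp_mean I y n i - mu i| <= 2 * eps /\
    r * w i <= (pulls I n i)%:R / n%:R.
  have [Hm Hw] := HN n (leq_addr _ _) i; split.
    by apply: HK => //; apply: leq_trans K0n; exact: leq_bigmax.
  have := epsw i; move: Hw; rewrite ler_norml /r; lra.
have thr : threshold C alpha delta n < r ^+ 3 * Gamma * n%:R.
  apply: HK' => //.
  by move: xn; rewrite /x -ler_pdivlMl ?divr_gt0// invf_div.
(* The maximum over candidate arms is bounded below by the term of the best arm [i1]. *)
apply: (@lt_le_trans _ _
  (\big[mine/+oo]_(j < k | j != i1) (Zstat sigma I y n i1 j)%:E)%E); last first.
  exact: le_bigmax.
apply: lt_bigmin => [|j ji1]; first exact: ltry.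
rewrite lte_fin (lt_le_trans thr)// (hGamma j ji1) -w1.
have [m1n p1n] := near_n i1; have [mjn pjn] := near_n j.
apply: Zstat_lower_bound => //; first exact/ltW/mu1.
have := epsmu j ji1; move: m1n mjn; rewrite !ler_norml /r; lra.
Qed.

(** * Integration of the pathwise bound and passage to the limit *)

Theorem theorem3 (R : realType) (k : nat) (hk : (1 < k)%N)
  (sigma : R) (sigma_gt0 : 0 < sigma)
  (mu : 'I_k -> R) (mu_decr : forall i j : 'I_k, (i < j)%N -> mu j < mu i)
  (prior_mean : 'I_k -> R) (prior_sd : 'I_k -> \bar R)
  (prior_ok : valid_prior prior_mean prior_sd)
  (beta : R) (beta01 : 0 < beta < 1)
  (w : 'I_k -> R) (hw : is_proportions hk mu beta w)
  (Gamma : R) (hGamma : is_complexity hk sigma mu beta w Gamma)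
  (dO dS : measure_display)
  (Omega : measurableType dO) (S : measurableType dS)
  (P : probability Omega R)
  (U : {mfun Omega >-> S}) (Y : nat -> 'I_k -> {RV P >-> R})
  (hmodel : bandit_model sigma mu U Y)
  (rule : sampling_rule R k S)
  (hT : forall eps : R, 0 < eps ->
    (\int[P]_om T_eps sigma prior_mean prior_sd mu w eps
                  (arms rule U Y om) (rewards Y om) < +oo)%E)
  (alpha : R) (alpha_gt1 : 1 < alpha)
  (C : R) (C_gt0 : 0 < C) (hC : valid_constant hk alpha C) :
  (limf_esup (fun delta : R =>
      (\int[P]_om chernoff_time sigma (threshold C alpha delta)
                    (arms rule U Y om) (rewards Y om)) / (ln (delta^-1))%:E)
     0^'+ <= (alpha / Gamma)%:E)%E.

Proof.
have [eps eps0 [K HK]] :=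
  @chernoff_time_le_T_eps _ _ _ _ _ _ _ _ _ _ _ _ sigma_gt0 mu_decr prior_ok
  (proj1 (andP beta01)) hw hGamma alpha_gt1 C_gt0.
have := hT eps eps0; set E := (\int[P]_om _)%E => Efin.
have E0 : (0 <= E)%E by apply: integral_ge0 => om _; exact: inf_time_ge0.
have [beta0 _] := andP beta01.
have Gamma0 := complexity_gt0 _ _ _ _ _ _ _ _ sigma_gt0 mu_decr beta0 hw hGamma.
(* The intercept is a genuine real, since the integral [E] of [T_eps] is finite at this [eps], which
   was fixed before [delta]. *)
apply: (@limf_esup_le_affine_ln _ _ (fine E + K%:R)) => delta d01.
have L0 : 0 <= ln delta^-1.
  by case/andP: d01 => d0 d1; rewrite lnV ?posrE// oppr_ge0 ln_le0// ltW.
rewrite -addrA EFinD fineK ?ge0_fin_numE//.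
apply: integral_le_add_cst => [|om|om|om].
- by rewrite addr_ge0// mulr_ge0// divr_ge0// ltW// (lt_trans _ alpha_gt1).
- exact: inf_time_ge0.
- exact: inf_time_ge0.
- exact: HK.
Qed.
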